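(* Let $(\Gamma,u)$ be a generalized $n$-gon with (non-discrete) valuation and weight sequence $(a_1,\dots,a_{n-1},a_{n+1},\dots,a_{2n-1})$. If $u$ has non-zero values (that is, $u(x,y)\neq 0$ for some pair of distinct adjacent elements $x,y$), then $(a_1,\dots,a_{n-1},a_{n+1},\dots,a_{2n-1})$ is a scalar multiple of the sequence $(b_1,\dots,b_{n-1},b_{n+1},\dots,b_{2n-1})$ with $b_i=|\sin(i\pi/n)|$.
   Context: Generalized polygons. A generalized $n$-gon ($n\ge 2$) $\Gamma=(P,B,\mathrm{I})$ consists of disjoint sets $P$ (points) and $B$ (lines) and a symmetric incidence relation $\mathrm{I}$ between $P$ and $B$ such that: (GP1) every element of $P\cup B$ is incident with at least three other elements; (GP2) for all $x,y\in P\cup B$ there is a sequence $x_0=x,x_1,\dots,x_k=y$ with $x_{i-1}\,\mathrm{I}\,x_i$ for $1\le i\le k$ and $k\le n$; (GP3) this sequence is unique whenever $k<n$. ''Element'' means element of $P\cup B$. Two points are collinear if incident with a common line, two lines are concurrent if incident with a common point; elements are adjacent if collinear or concurrent (an element is adjacent to itself). Valuations. A generalized $n$-gon with (non-discrete) valuation and weight sequence $(a_1,\dots,a_{n-1},a_{n+1},\dots,a_{2n-1})$, where all $a_i$ are positive real numbers, is a pair $(\Gamma,u)$ with $\Gamma$ a generalized $n$-gon and $u$ a function on pairs of adjacent elements with values in $[0,\infty]$ such that: (U1) for each element $z$ there are elements $x,y$ incident with $z$ with $u(x,y)=0$; (U2) $u(x,y)=\infty$ if and only if $x=y$; (U3)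 if $x,y,z$ are points on a common line or lines through a common point, then $u(x,y)<u(y,z)$ implies $u(x,z)=u(x,y)$; (U4) whenever $x_1\,\mathrm{I}\,x_2\,\mathrm{I}\cdots\mathrm{I}\,x_{2n}\,\mathrm{I}\,x_1$ with $x_i\in P\cup B$ (indices modulo $2n$, so $x_0=x_{2n}$), one has $\sum_{i=1}^{n-1}a_iu(x_{i-1},x_{i+1})=\sum_{i=n+1}^{2n-1}a_iu(x_{i-1},x_{i+1})$. (Symmetry $u(x,y)=u(y,x)$ follows from (U2), (U3).) *)

(* Defs.v *)
From HB Require Import structures.
From mathcomp Require Import all_boot all_order all_algebra.
From mathcomp Require Import all_classical all_reals all_analysis.
Set Implicit Arguments.
Unset Strict Implicit.
Unset Printing Implicit Defensive.
Import Order.TTheory GRing.Theory Num.Theory.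
Local Open Scope ring_scope.

(* The elements of a point-line geometry are the terms of [P + B]: the points
   are the [inl p] and the lines the [inr l], so that P and B are disjoint.
   [I] is extended to a symmetric relation on elements; two points (or two
   lines) are never incident. *)
Definition incident (P B : Type) (I : P -> B -> Prop) (x y : P + B) : Prop :=
  match x, y with
  | inl p, inr l => I p l
  | inr l, inl p => I p l
  | _, _ => False
  end.

(* Incidence only relates a point and a line, so this holds exactly for
   collinear points and for concurrent lines. *)
Definition adjacent_elts (P B : Type) (I : P -> B -> Prop) (x y : P + B) : Prop :=
  exists z, incident I x z /\ incident I y z.

(* [s 0, ..., s k] is a sequence of consecutively incident elements; the values
   of [s] beyond [k] are irrelevant. *)
Definition incidence_seq (P B : Type) (I : P -> B -> Prop)
    (k : nat) (s : nat -> P + B) : Prop :=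
  forall i : nat, (i < k)%N -> incident I (s i) (s i.+1).

Definition non_stammering (P B : Type) (k : nat) (s : nat -> P + B) : Prop :=
  forall i : nat, (i.+1 < k)%N -> s i <> s i.+2.

(* The uniqueness axiom [gp3] concerns sequences without backtracking
   ... s i, s i.+1, s i ...: a sequence with backtracking is never unique, as
   x I y I x holds for each of the at least three y incident with x. *)
Record generalized_polygon (n : nat) (P B : Type) (I : P -> B -> Prop) : Prop :=
  GeneralizedPolygon {
    gp_ge2 : (2 <= n)%N;
    gp1 : forall x : P + B, exists y1 y2 y3 : P + B,
      [/\ incident I x y1, incident I x y2 & incident I x y3] /\
      [/\ y1 <> y2, y1 <> y3 & y2 <> y3];
    gp2 : forall x y : P + B, exists (k : nat) (s : nat -> P + B),
      [/\ (k <= n)%N, incidence_seq I k s, s 0%N = x & s k = y];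
    gp3 : forall (k l : nat) (s t : nat -> P + B),
      (k < n)%N -> (l < n)%N ->
      incidence_seq I k s -> non_stammering k s ->
      incidence_seq I l t -> non_stammering l t ->
      s 0%N = t 0%N -> s k = t l ->
      k = l /\ forall i : nat, (i <= k)%N -> s i = t i
  }.

(* The weights are the [a i] with 1 <= i <= 2n-1 and i <> n. *)
Definition weight_index (n i : nat) : bool :=
  [&& (1 <= i)%N, (i <= n.*2.-1)%N & i != n].

(* [u] is a total function, but it is only constrained on adjacent_elts pairs.
   In [val_u4], the closed sequence x_1 I x_2 I ... I x_2n I x_1 is given
   together with x_0 = x_2n; it may be degenerate, so that both sums may be
   infinite. *)
Record valuation (R : realType) (n : nat) (P B : Type) (I : P -> B -> Prop)
    (a : nat -> R) (u : P + B -> P + B -> \bar R) : Prop :=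
  Valuation {
    val_weight_gt0 : forall i : nat, weight_index n i -> 0 < a i;
    val_ge0 : forall x y : P + B, adjacent_elts I x y -> (0 <= u x y)%E;
    val_u1 : forall z : P + B, exists x y : P + B,
      [/\ incident I x z, incident I y z & u x y = 0%E];
    val_u2 : forall x y : P + B, adjacent_elts I x y -> (u x y = +oo%E <-> x = y);
    val_u3 : forall x y z w : P + B,
      incident I x w -> incident I y w -> incident I z w ->
      (u x y < u y z)%E -> u x z = u x y;
    val_u4 : forall x : nat -> P + B,
      incidence_seq I n.*2 x -> x 0%N = x n.*2 ->
      (\sum_(1 <= i < n) (a i)%:E * u (x i.-1) (x i.+1) =
       \sum_(n.+1 <= i < n.*2) (a i)%:E * u (x i.-1) (x i.+1))%E
  }.

(* Main.v *)
Require Import Defs.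
From HB Require Import structures.
From mathcomp Require Import all_boot all_order all_algebra.
From mathcomp Require Import all_classical all_reals all_analysis.
From mathcomp Require Import zify ring lra.
Import Order.TTheory GRing.Theory Num.Theory.
Local Open Scope ring_scope.
Set Implicit Arguments.
Unset Strict Implicit.
Unset Printing Implicit Defensive.

(** Extend the weights to a 2n-periodic sequence c, with c_i = a_i for
    0 < i < n, c_i = - a_i for n < i < 2n and c_0 = c_n = 0.  If v_i is the
    value u(x_(i-1), x_(i+1)) in a closed walk of length 2n, the axiom for all
    rotations of the walk says that sum_j c_(j+k) v_j = 0 for every k
    (cyclic_correlation).  It then suffices to prove c_(k+1) + c_(k-1) = l c_k
    for 0 < k < n with a constant l: a sequence satisfying this recurrence,
    vanishing at 0 and n and positive in between is a multiple of
    sin (k pi / n) (sine_unique).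

    By the ultrametric law every walk can be prolonged with value 0, so one
    nonzero value d can be placed at any prescribed index of a walk whose other
    values vanish (one_turn_walk).  Following such a walk of length n back and
    forth gives c_(-i) = - c_i (weight_opp).  Placing d at an end of a walk of
    length n with otherwise zero values, and closing it up to an ordinary n-gon,
    gives c_(n-k) = c_k (weight_rev).

    The recurrence comes from thickness.  Two walks p, q of length n without
    backtracking, with the same ends and different last steps, form an ordinary n-gon.  Subtracting
    the equations of the rotations by k and by - k gives
    D_k(p) + D_k(q) = 2 c_k delta(p, q), where
    D_k(p) = sum_i (c_(i+k) - c_(i-k)) p_i only involves the inner values of p,
    and delta(p, q), the difference of the values at the two ends, does not
    depend on k (walk_pair_moment).  There is a third walk r, and the equations
    of the three pairs can be solved for D_k(p): it is c_k times a number
    independent of k (moment_proportional).  When p has the single nonzero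
    value d, at index 1, D_k(p) is (c_(k+1) + c_(k-1)) d. *)

(** * Sequences satisfying the recurrence of the sine *)

(** Discrete Green identity: each step of the Wronskian adds [(l - m) f_k g_k]. *)
Lemma wronskian_sum (R : comPzRingType) (n : nat) (l m : R) (f g : nat -> R) :
    f 0%N = 0 -> g 0%N = 0 ->
    (forall k, (0 < k < n)%N -> f k.+1 + f k.-1 = l * f k) ->
    (forall k, (0 < k < n)%N -> g k.+1 + g k.-1 = m * g k) ->
  forall k, (k < n)%N ->
    f k.+1 * g k - f k * g k.+1 = (l - m) * \sum_(1 <= i < k.+1) f i * g i.
Proof.
move=> f0 g0 frec grec; elim=> [_|k IHk ltkn].
  by rewrite f0 g0 big_geq // !(mulr0, mul0r) subrr.
rewrite big_nat_recr //= mulrDr -IHk; last exact: ltnW.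
have -> : f k.+2 = l * f k.+1 - f k by rewrite -frec ?ltkn //= addrK.
have -> : g k.+2 = m * g k.+1 - g k by rewrite -grec ?ltkn //= addrK.
ring.
Qed.

Lemma sine_gt0 (R : realType) (n k : nat) :
  (0 < k < n)%N -> 0 < sin (k%:R * pi / n%:R) :> R.
Proof.
move=> /andP[k_gt0 ltkn]; have n_gt0 : (0 : R) < n%:R by rewrite ltr0n (ltn_trans k_gt0).
apply: sin_gt0_pi; apply/andP; split.
  by rewrite divr_gt0 // mulr_gt0 ?pi_gt0 ?ltr0n.
by rewrite ltr_pdivrMr // mulrC ltr_pM2l ?pi_gt0 // ltr_nat.
Qed.

Lemma sine_recurrence (R : realType) (n k : nat) : (0 < k)%N ->
  sin (k.+1%:R * pi / n%:R) + sin (k.-1%:R * pi / n%:R)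
  = 2 * cos (pi / n%:R) * sin (k%:R * pi / n%:R) :> R.
Proof.
case: k => // k _ /=.
set y : R := pi / n%:R.
have -> : k.+2%:R * pi / n%:R = k.+1%:R * pi / n%:R + y :> R.
  by rewrite -[in LHS]addn1 natrD !mulrDl mul1r.
have -> : k%:R * pi / n%:R = k.+1%:R * pi / n%:R - y :> R.
  by rewrite -[in RHS]addn1 natrD !mulrDl mul1r addrK.
rewrite sinB sinD; ring.
Qed.

(** The Wronskian of [c] and the sine vanishes at both ends; as it grows by the
    difference of the two recurrence constants times a positive sum, these
    constants agree.  Then the value at 1 determines the sequence. *)
Lemma sine_unique (R : realType) (n : nat) (l : R) (c : nat -> R) :
    (2 <= n)%N -> c 0%N = 0 -> c n = 0 ->
    (forall k, (0 < k < n)%N -> 0 < c k) ->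
    (forall k, (0 < k < n)%N -> c k.+1 + c k.-1 = l * c k) ->
  exists C : R, forall k, (k <= n)%N -> c k = C * sin (k%:R * pi / n%:R).
Proof.
move=> n_ge2 c0 cn c_gt0 crec.
pose s (k : nat) : R := sin (k%:R * pi / n%:R).
have s0 : s 0%N = 0 by rewrite /s !mul0r sin0.
have sn : s n = 0.
  by rewrite /s mulrAC divff ?mul1r ?sinpi // pnatr_eq0 -lt0n ltnW.
have srec k : (0 < k < n)%N -> s k.+1 + s k.-1 = 2 * cos (pi / n%:R) * s k.
  by case/andP=> k_gt0 _; exact: sine_recurrence.
have Wr := @wronskian_sum _ _ _ _ _ _ c0 s0 crec srec.
have lE : l = 2 * cos (pi / n%:R).
  apply/eqP; rewrite -subr_eq0; have /eqP := Wr n.-1 ltac:(lia).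
  rewrite (_ : n.-1.+1 = n); last by lia.
  rewrite cn sn mul0r mulr0 subrr eq_sym mulf_eq0 => /orP[//|/eqP sum0].
  suff: 0 < \sum_(1 <= i < n) c i * s i by rewrite sum0 ltxx.
  rewrite big_ltn // ltr_wpDr ?mulr_gt0 ?c_gt0 ?sine_gt0 //.
  rewrite big_nat_cond sumr_ge0 // => i /andP[/andP[i_ge2 ltin] _].
  by rewrite mulr_ge0 // ltW ?c_gt0 ?sine_gt0 // ltin andbT ltnW.
have s1_neq0 : s 1%N != 0 by rewrite gt_eqF ?sine_gt0.
exists (c 1%N / s 1%N).
suff H k : (k < n)%N ->
    c k = c 1%N / s 1%N * s k /\ c k.+1 = c 1%N / s 1%N * s k.+1.
  by case=> [|k] lekn; [rewrite -[sin _]/(s 0%N) c0 s0 mulr0 | case: (H k lekn)].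
elim: k => [_|k IHk ltkn]; first by rewrite c0 s0 mulr0 divfK.
have [ck ck1] := IHk (ltnW ltkn); split=> //.
have -> : c k.+2 = l * c k.+1 - c k by rewrite -crec ?ltkn //= addrK.
have -> : s k.+2 = l * s k.+1 - s k by rewrite lE -srec ?ltkn //= addrK.
by rewrite ck ck1 mulrBr mulrCA.
Qed.

(** * Weights and cyclic sums *)

Definition signed_weight (R : realType) (n : nat) (a : nat -> R) (i : nat) : R :=
  let r := (i %% n.*2)%N in
  if (0 < r < n)%N then a r else if (n < r)%N then - a r else 0.

Lemma signed_weight_periodic (R : realType) (n : nat) (a : nat -> R) (i : nat) :
  signed_weight n a (i + n.*2)%N = signed_weight n a i.
Proof. by rewrite /signed_weight modnDr. Qed.

Lemma signed_weight_pos (R : realType) (n : nat) (a : nat -> R) (i : nat) :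
  (0 < i < n)%N -> signed_weight n a i = a i.
Proof.
by move=> ltin; rewrite /signed_weight modn_small ?ltin //; lia.
Qed.

Lemma signed_weight_neg (R : realType) (n : nat) (a : nat -> R) (i : nat) :
  (n < i < n.*2)%N -> signed_weight n a i = - a i.
Proof.
move=> /andP[ltni lti2n].
by rewrite /signed_weight modn_small // ltni (_ : (i < n)%N = false) ?andbF //; lia.
Qed.

Lemma signed_weight0 (R : realType) (n : nat) (a : nat -> R) :
  signed_weight n a 0%N = 0.
Proof. by rewrite /signed_weight mod0n. Qed.

Lemma signed_weight_half (R : realType) (n : nat) (a : nat -> R) :
  (0 < n)%N -> signed_weight n a n = 0.
Proof. by move=> n_gt0; rewrite /signed_weight modn_small ?ltnn ?andbF //; lia. Qed.

Lemma signed_weight_odd (R : realType) (n : nat) (a : nat -> R) :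
    (0 < n)%N -> (forall j, (0 < j < n)%N -> a j = a (n.*2 - j)%N) ->
  forall i j, (n.*2 %| i + j)%N -> signed_weight n a i = - signed_weight n a j.
Proof.
move=> n_gt0 a_odd i j; rewrite /dvdn -modnDm /signed_weight /=.
have := ltn_pmod i (_ : 0 < n.*2)%N; have := ltn_pmod j (_ : 0 < n.*2)%N.
move: (i %% n.*2)%N (j %% n.*2)%N => r s lts ltr /eqP rs0.
have {}lts := lts ltac:(lia); have {}ltr := ltr ltac:(lia).
have rs : (r = 0 /\ s = 0 \/ r + s = n.*2)%N.
  case: (ltnP (r + s) n.*2) => rs_n; first by rewrite modn_small in rs0 => //; lia.
  right; move: rs0; rewrite -(subnK rs_n) modnDr modn_small; lia.
case: rs => [[-> ->]|rs]; first by rewrite /= oppr0.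
case: (ltngtP r n) => [ltrn|ltnr|rn].
- have s_gt : (n < s)%N by lia.
  have r_gt0 : (0 < r)%N by lia.
  rewrite (_ : (s < n)%N = false) ?s_gt ?r_gt0 ?andbF /=; last by lia.
  by rewrite opprK a_odd ?r_gt0 //; congr a; lia.
- have [s_gt0 s_lt] : (0 < s)%N /\ (s < n)%N by lia.
  rewrite s_gt0 s_lt andbF /= (a_odd s) ?s_gt0 //; congr (- a _); lia.
- have -> : s = n by lia.
  by rewrite ?rn !ltnn !andbF /= oppr0.
Qed.

Lemma sum_periodic (R : zmodType) (N : nat) (f : nat -> R) :
    (forall i, f (i + N)%N = f i) ->
  forall k, \sum_(0 <= i < N) f (i + k)%N = \sum_(0 <= i < N) f i.
Proof.
move=> fN; elim=> [|k <-]; first by apply: eq_bigr => i _; rewrite addn0.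
case: N fN => [|N] fN; first by rewrite !big_geq.
rewrite [LHS]big_nat_recr // [RHS]big_nat_recl //= addrC; congr (_ + _).
  by rewrite add0n -(fN k); congr f; lia.
by apply: eq_bigr => i _; congr f; lia.
Qed.

Lemma sum_signed_weight (R : realType) (n : nat) (a v : nat -> R) : (0 < n)%N ->
  \sum_(0 <= i < n.*2) signed_weight n a i * v i
  = \sum_(1 <= i < n) a i * v i - \sum_(n.+1 <= i < n.*2) a i * v i.
Proof.
move=> n_gt0.
rewrite (@big_cat_nat _ _ _ n) //=; [|by lia].
rewrite big_ltn // [X in _ + X]big_ltn; [|by lia].
rewrite signed_weight0 signed_weight_half // !mul0r !add0r -sumrN.
congr (_ + _); apply: eq_big_nat => i lti; first by rewrite signed_weight_pos.
by rewrite signed_weight_neg // mulNr.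
Qed.

(** Shifting the summation index moves the rotation from [v] to the weights. *)
Lemma cyclic_correlation (R : realType) (n : nat) (a v : nat -> R) : (0 < n)%N ->
    (forall i, v (i + n.*2)%N = v i) ->
    (forall k, \sum_(1 <= i < n) a i * v (i + k)%N
             = \sum_(n.+1 <= i < n.*2) a i * v (i + k)%N) ->
  forall k, (k <= n.*2)%N ->
    \sum_(0 <= j < n.*2) signed_weight n a (j + k)%N * v j = 0.
Proof.
move=> n_gt0 vN vE k lek.
have cvN i : signed_weight n a (i + n.*2)%N * v (i + n.*2 + (n.*2 - k))%N
           = signed_weight n a i * v (i + (n.*2 - k))%N.
  by rewrite signed_weight_periodic addnAC vN.
rewrite -[RHS](subrr (\sum_(1 <= i < n) a i * v (i + (n.*2 - k))%N)).
rewrite [X in _ = _ - X]vE -sum_signed_weight // -(sum_periodic cvN k).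
by apply: eq_bigr => i _; rewrite -addnA subnKC // vN.
Qed.

(** [n.*2 - k] stands for [- k], as [signed_weight] is periodic.  For the
    weights [sin (i pi / n)] this is [2 sin (k pi / n) cos (i pi / n)], and
    [path_moment] below is then [2 sin (k pi / n)] times the first coordinate of
    the sum of plane vectors of lengths [p i] and angles [i pi / n]. *)
Definition reflected_weight (R : realType) (n : nat) (a : nat -> R) (k i : nat) : R :=
  signed_weight n a (i + k)%N - signed_weight n a (i + (n.*2 - k))%N.

Definition path_moment (R : realType) (n : nat) (a : nat -> R) (k : nat)
    (p : nat -> R) : R :=
  \sum_(1 <= i < n) reflected_weight n a k i * p i.

(** Difference of the correlations with shifts [k] and [- k].  Its coefficients
    are even in the index, hence the two halves of the cycle, both read from
    index 0 to index [n], enter symmetrically. *)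
Lemma moment_pair (R : realType) (n : nat) (a v p q : nat -> R) (x y : R) :
    (0 < n)%N -> (forall j, (0 < j < n)%N -> a j = a (n.*2 - j)%N) ->
    (forall k, (k <= n.*2)%N ->
       \sum_(0 <= j < n.*2) signed_weight n a (j + k)%N * v j = 0) ->
    v 0%N = y -> v n = x ->
    (forall i, (0 < i < n)%N -> v i = p i) ->
    (forall i, (0 < i < n)%N -> v (n.*2 - i)%N = q i) ->
  forall k, (k <= n)%N ->
    path_moment n a k p + path_moment n a k q
    = 2 * (signed_weight n a (n - k) * x - signed_weight n a k * y).
Proof.
move=> n_gt0 a_odd vE v0 vn vp vq k lekn.
have odd := @signed_weight_odd _ _ _ n_gt0 a_odd.
have wE : \sum_(0 <= j < n.*2) reflected_weight n a k j * v j = 0.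
  under eq_bigr do rewrite mulrBl.
  by rewrite sumrB !vE ?subrr ?leq_subr //; lia.
move: wE; rewrite (@big_cat_nat _ _ _ n) //=; [|by lia].
rewrite big_ltn // [X in _ + X]big_ltn; [|by lia].
rewrite v0 vn.
rewrite (eq_big_nat _ _ (F2 := fun i => reflected_weight n a k i * p i)); last first.
  by move=> i lti; rewrite vp.
rewrite -/(path_moment n a k p).
have -> : \sum_(n.+1 <= i < n.*2) reflected_weight n a k i * v i = path_moment n a k q.
  rewrite -[n.+1]add1n big_addn (_ : n.*2 - n = n)%N; last by lia.
  rewrite big_nat_rev; apply: eq_big_nat => i lti.
  rewrite (_ : 1 + n - i.+1 + n = n.*2 - i)%N; last by lia.
  rewrite vq // /reflected_weight; congr (_ * _).
  rewrite (odd (n.*2 - i + k)%N (i + (n.*2 - k))%N); last by apply/dvdnP; exists 2%N; lia.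
  rewrite (odd (n.*2 - i + (n.*2 - k))%N (i + k)%N); last by apply/dvdnP; exists 2%N; lia.
  by rewrite opprK addrC.
have -> : reflected_weight n a k 0 = 2 * signed_weight n a k.
  rewrite /reflected_weight !add0n (odd (_ - _)%N k); last by rewrite subnK //; lia.
  ring.
have -> : reflected_weight n a k n = - (2 * signed_weight n a (n - k)).
  rewrite /reflected_weight (odd (n + k)%N (n - k)%N); last by apply/dvdnP; exists 1%N; lia.
  rewrite (_ : n + (n.*2 - k) = n - k + n.*2)%N; last by lia.
  rewrite signed_weight_periodic; ring.
move=> wE; apply/eqP; rewrite -subr_eq0 -wE; apply/eqP; ring.
Qed.

(** * Walks and opposite elements *)

Section Walks.

Variables (P B : Type) (I : P -> B -> Prop).
Implicit Types (x y z : P + B) (s t p q : nat -> P + B).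

Lemma incident_sym x y : incident I x y -> incident I y x.
Proof. by case: x; case: y. Qed.

Definition is_point x : bool := if x is inl _ then true else false.

Lemma is_point_incident x y : incident I x y -> is_point y = ~~ is_point x.
Proof. by case: x; case: y. Qed.

Lemma is_point_walk k s : incidence_seq I k s ->
  is_point (s k) = is_point (s 0%N) (+) odd k.
Proof.
elim: k => [|k IHk] sI; first by rewrite addbF.
rewrite (is_point_incident (sI _ _)) // IHk /= ?addbN // => i ltik.
exact/sI/ltnW.
Qed.

(** Cutting out one backtrack at a time. *)
Lemma nonstammering_walk k s : incidence_seq I k s -> exists l t,
  [/\ (l <= k)%N, incidence_seq I l t, non_stammering l t, t 0%N = s 0%N
    & t l = s k].
Proof.
elim/ltn_ind: k s => k IHk s sI.
have [sN|/existsNP[i /not_implyP[ltik /contrapT si]]] := pselect (non_stammering k s).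
  by exists k, s.
pose t j := if (j <= i)%N then s j else s j.+2.
have tI : incidence_seq I k.-2 t.
  move=> j ltj; rewrite /t; case: (ltngtP j i) => [ltji|ltij|ji].
  - by apply: sI; lia.
  - by apply: sI; lia.
  - by rewrite ji si; apply: sI; lia.
have [|l [t' [lel t'I t'N t'0 t'l]]] := IHk k.-2 _ t tI; first by lia.
exists l, t'; split=> //; first by lia.
rewrite t'l /t; case: leqP => lei.
  have ki : k = i.+2 by lia.
  by rewrite ki /= si.
by congr s; lia.
Qed.

Definition append_to (k : nat) s y : nat -> P + B :=
  fun i => if (i <= k)%N then s i else y.

Lemma append_walk k s y : incidence_seq I k s -> incident I (s k) y ->
  incidence_seq I k.+1 (append_to k s y).
Proof.
move=> sI sy i; rewrite ltnS /append_to => leik; rewrite leik.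
by case: (ltngtP i k) leik => // [ltik|->] _; first exact: sI.
Qed.

Lemma append_nonstammering k s y : non_stammering k s -> s k.-1 <> y ->
  non_stammering k.+1 (append_to k s y).
Proof.
move=> sN sy i; rewrite ltnS /append_to => leik.
rewrite (ltnW leik); case: (ltngtP i.+1 k) leik => // [ltik|ki] _; first exact: sN.
by rewrite -ki in sy.
Qed.

Variables (n : nat) (ngon : generalized_polygon n I).

Let n_ge2 : (2 <= n)%N := gp_ge2 ngon.

(** A shorter walk could be prolonged by [s n.-1] while staying, for reasons of
    parity, below the length [n] where uniqueness holds; it would then agree
    with [s], which would stammer at its end. *)
Lemma opposite_distance s l t : incidence_seq I n s -> non_stammering n s ->
  incidence_seq I l t -> t 0%N = s 0%N -> t l = s n -> (n <= l)%N.
Proof.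
move=> sI sN tI t0 tl; rewrite leqNgt; apply/negP => ltln.
have [m [r [leml rI rN r0 rm]]] := nonstammering_walk tI.
have odd_m : odd m = odd n.
  have := is_point_walk rI; rewrite rm tl r0 t0 (is_point_walk sI).
  by move/addbI.
have sI1 : incidence_seq I n.-1 s by move=> i lti; apply: sI; lia.
have sN1 : non_stammering n.-1 s by move=> i lti; apply: sN; lia.
have s_last : incident I (s n.-1) (s n).
  by rewrite -{2}(prednK (ltnW n_ge2)); apply: sI; lia.
have m_lt : (m.+1 < n)%N.
  have : m.+1 != n by apply/eqP => mn; move: odd_m; rewrite -mn /=; case: odd.
  lia.
have [rs|rs] := pselect (r m.-1 = s n.-1).
  have rI1 : incidence_seq I m.-1 r by move=> i lti; apply: rI; lia.
  have rN1 : non_stammering m.-1 r by move=> i lti; apply: rN; lia.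
  have [||||mn _] := gp3 ngon _ _ rI1 rN1 sI1 sN1; rewrite ?r0 //; lia.
have rxI : incidence_seq I m.+1 (append_to m r (s n.-1)).
  by apply: append_walk => //; rewrite rm tl; exact: incident_sym.
have rxN := append_nonstammering rN rs.
have [||||mn rxs] := gp3 ngon _ _ rxI rxN sI1 sN1; rewrite ?/append_to ?ltnn ?r0 //.
  lia.
have /= := rxs m (leqnSn m); rewrite /append_to leqnn rm tl => sn.
apply: (sN m); first by lia.
by rewrite -sn mn; congr s; lia.
Qed.

(** The ends of [p] are at distance [n], so [y] is at distance exactly [n.-1]
    from [p 0], and a shortest walk to [y] does not pass through [p n]. *)
Lemma opposite_walk p y : incidence_seq I n p -> non_stammering n p ->
    incident I (p n) y ->
  exists q, [/\ incidence_seq I n q, non_stammering n q, q 0%N = p 0%N,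
    q n = p n & q n.-1 = y].
Proof.
move=> pI pN py.
have [k [t' [lek t'I t'0 t'k]]] := gp2 ngon (p 0%N) y.
have [l [t [lel tI tN t0 tl]]] := nonstammering_walk t'I.
have ly : t l = y by rewrite tl.
have lt_ln : (l < n)%N.
  rewrite ltn_neqAle (leq_trans lel lek) andbT; apply/eqP => ln.
  have := is_point_walk tI; rewrite ly t0 t'0 ln -(is_point_walk pI).
  by rewrite (is_point_incident py); case: is_point.
have qI : incidence_seq I l.+1 (append_to l t (p n)).
  by apply: append_walk => //; rewrite ly; exact: incident_sym.
have ln : l.+1 = n.
  apply/eqP; rewrite eqn_leq lt_ln.
  by apply: (opposite_distance pI pN qI); rewrite /append_to ?ltnn ?t0 ?t'0.
have qN : non_stammering l.+1 (append_to l t (p n)).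
  apply: append_nonstammering => // tp.
  have tI1 : incidence_seq I l.-1 t by move=> i lti; apply: tI; lia.
  by have := opposite_distance pI pN tI1 (etrans t0 t'0) tp; lia.
rewrite ln in qI qN; exists (append_to l t (p n)); split=> //.
- by rewrite /append_to /= t0.
- by rewrite /append_to leqNgt lt_ln.
- by rewrite /append_to -[in n.-1]ln leqnn.
Qed.

(** Otherwise the tails would be two walks of length [n.-1] with the same ends. *)
Lemma distinct_first_steps p q : incidence_seq I n p -> non_stammering n p ->
    incidence_seq I n q -> non_stammering n q -> p n = q n ->
  p n.-1 <> q n.-1 -> p 1%N <> q 1%N.
Proof.
move=> pI pN qI qN pqn pq_neq pq1; apply: pq_neq.
have tailI s : incidence_seq I n s -> incidence_seq I n.-1 (fun i => s i.+1).
  by move=> sI i lti; apply: sI; lia.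
have tailN s : non_stammering n s -> non_stammering n.-1 (fun i => s i.+1).
  by move=> sN i lti; apply: sN; lia.
have n1 : (n.-1.+1 = n)%N by lia.
have [||||_ pq] := gp3 ngon _ _ (tailI _ pI) (tailN _ pN) (tailI _ qI) (tailN _ qN);
  rewrite ?n1 //; try lia.
have := pq n.-2 ltac:(lia); rewrite (_ : n.-2.+1 = n.-1)%N //; lia.
Qed.

End Walks.

(** * Values along walks *)

Section Values.

Variables (R : realType) (n : nat) (P B : Type) (I : P -> B -> Prop).
Variables (a : nat -> R) (u : P + B -> P + B -> \bar R).
Hypothesis (ngon : generalized_polygon n I) (uval : valuation n I a u).
Implicit Types (x y z w : P + B) (s t p q r : nat -> P + B).

Lemma val_sym x y w : incident I x w -> incident I y w -> u x y = u y x.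
Proof.
move=> xw yw; have uxx z : incident I z w -> u z z = +oo%E.
  by move=> zw; apply/(val_u2 uval) => //; exists w.
case: (ltgtP (u x y) (u y x)) => // lt_u.
  by have := val_u3 uval xw yw xw lt_u; rewrite uxx // => uE; rewrite -uE ltNge leey in lt_u.
by have := val_u3 uval yw xw yw lt_u; rewrite uxx // => uE; rewrite -uE ltNge leey in lt_u.
Qed.

Lemma val_fin x y w : incident I x w -> incident I y w -> x <> y ->
  u x y \is a fin_num.
Proof.
move=> xw yw xy; have xyI : adjacent_elts I x y by exists w.
rewrite ge0_fin_numE; last exact: val_ge0 uval _ _ xyI.
by rewrite ltey; apply/eqP => /(val_u2 uval xyI).
Qed.

Lemma val_neq x y w : incident I x w -> incident I y w ->
  u x y \is a fin_num -> x <> y.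
Proof.
move=> xw yw u_fin xy; have xyI : adjacent_elts I x y by exists w.
by have /(val_u2 uval xyI) uoo := xy; rewrite uoo in u_fin.
Qed.

(** Of two elements through [w] with mutual value 0, one has value 0 with [x] by
    the ultrametric law. *)
Lemma zero_step x w : incident I x w -> exists y, incident I w y /\ u x y = 0%E.
Proof.
move=> xw; have [y [z [yw zw yz0]]] := val_u1 uval w.
have [xy0|xy_neq0] := eqVneq (u x y) 0%E.
  by exists y; split; first exact: incident_sym.
exists z; split; first exact: incident_sym.
have zy0 : u z y = 0%E by rewrite (val_sym zw yw).
have lt_u : (u z y < u y x)%E.
  rewrite zy0 (val_sym yw xw) lt0e xy_neq0 (val_ge0 uval) //.
  by exists w.
by rewrite (val_sym xw zw) (val_u3 uval zw yw xw lt_u).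
Qed.

Lemma zero_walk x y : incident I x y -> exists s,
  [/\ s 0%N = x, s 1%N = y, forall i, incident I (s i) (s i.+1)
    & forall i, u (s i) (s i.+2) = 0%E].
Proof.
move=> xy.
have stepP (e : (P + B) * (P + B)) : exists z, incident I e.1 e.2 ->
    incident I e.2 z /\ u e.1 z = 0%E.
  have [/zero_step[z ez]|nI] := pselect (incident I e.1 e.2); last by exists x.
  by exists z.
have [f fP] := choice stepP.
pose e i := iter i (fun e => (e.2, f e)) (x, y).
have eI i : incident I (e i).1 (e i).2.
  by elim: i => [//|i IHi]; have [] := fP _ IHi.
exists (fun i => (e i).1); split=> // i.
by have [] := fP _ (eI i).
Qed.

(** Zero walks prolong [x], [w], [y] in both directions. *)
Lemma one_turn_walk x w y j : incident I x w -> incident I w y -> x <> y ->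
    (0 < j)%N -> exists s,
  [/\ forall i, incident I (s i) (s i.+1), forall i, s i <> s i.+2
    & forall i, (0 < i)%N -> u (s i.-1) (s i.+1) = if i == j then u x y else 0%E].
Proof.
move=> xw wy xy j_gt0.
have [b [b0 b1 bI bu]] := zero_walk (incident_sym xw).
have [f [f0 f1 fI fu]] := zero_walk wy.
(* [b] starts at [w] through [x] and is read backwards up to index [j]. *)
pose s i := if (i < j)%N then b (j - i)%N else f (i - j)%N.
have sb i : (i <= j)%N -> s i = b (j - i)%N.
  by rewrite /s; case: ltngtP => // ->; rewrite subnn b0 f0.
have sf i : (j <= i)%N -> s i = f (i - j)%N by rewrite /s ltnNge => ->.
have sI i : incident I (s i) (s i.+1).
  case: (ltnP i j) => ltij.
    rewrite !sb // 1?ltnW // (_ : j - i = (j - i.+1).+1)%N; last by lia.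
    exact/incident_sym/bI.
  by rewrite !sf 1?leqW // subSn.
have su i : (0 < i)%N -> u (s i.-1) (s i.+1) = if i == j then u x y else 0%E.
  case: i => // i _ /=; case: (ltngtP i.+1 j) => [ltij|ltji|ij].
  - rewrite !sb 1?(_ : j - i = (j - i.+2).+2)%N; [|by lia..].
    rewrite (@val_sym _ _ (b (j - i.+2).+1)) //; exact/incident_sym/bI.
  - by rewrite !sf 1?(_ : i.+2 - j = (i - j).+2)%N ?fu //; lia.
  - by rewrite sb ?sf -?ij ?leqnSn // !subSnn b1 f1.
exists s; split=> // i; apply: (val_neq (sI i) (incident_sym (sI i.+1))).
have := su i.+1 isT => /= ->; case: ifP => // _.
exact: val_fin xw (incident_sym wy) xy.
Qed.

(** Without backtracking at [i] the value is finite, and [fine] loses nothing. *)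
Definition turn p i : R := fine (u (p i.-1) (p i.+1)).

Lemma turn_ge0 p i : (forall j, incident I (p j) (p j.+1)) -> (0 < i)%N ->
  0 <= turn p i.
Proof.
case: i => // i pI _; apply/fine_ge0/(val_ge0 uval).
by exists (p i.+1); split; [exact: pI|exact/incident_sym/pI].
Qed.

Lemma u4_turn p : incidence_seq I n.*2 p -> p 0%N = p n.*2 ->
    (forall i, (0 < i < n.*2)%N -> i != n -> p i.-1 <> p i.+1) ->
  \sum_(1 <= i < n) a i * turn p i = \sum_(n.+1 <= i < n.*2) a i * turn p i.
Proof.
move=> pI p0 pN.
have termE i : (0 < i < n.*2)%N -> i != n ->
    ((a i)%:E * u (p i.-1) (p i.+1))%E = (a i * turn p i)%:E.
  move=> lti in_neq; rewrite EFinM fineK //.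
  have /andP[i_gt0 lti2n] := lti.
  apply: (@val_fin _ _ (p i)); last exact: pN.
    by rewrite -{2}(prednK i_gt0); apply: pI; lia.
  exact/incident_sym/pI.
apply: EFin_inj; rewrite -!sumEFin.
have := val_u4 uval pI p0.
rewrite (eq_big_nat _ _ (F2 := fun i => (a i * turn p i)%:E)); last first.
  by move=> i lti; apply: termE; lia.
rewrite [X in _ = X -> _](eq_big_nat _ _ (F2 := fun i => (a i * turn p i)%:E)) //.
by move=> i lti; apply: termE; lia.
Qed.

Lemma periodic_ind (Q : nat -> Prop) :
    (forall i, (i < n.*2)%N -> Q i) -> (forall i, Q i -> Q (i + n.*2)%N) ->
  forall i, Q i.
Proof.
move=> Qlt QD; elim/ltn_ind=> i IHi; case: (ltnP i n.*2) => [/Qlt //|le_i].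
rewrite -(subnK le_i); apply: QD; apply: IHi.
have := gp_ge2 ngon; lia.
Qed.

(** Made periodic, so that every rotation of the closed walk is a shift. *)
Definition there_and_back p q i : P + B :=
  let r := (i %% n.*2)%N in if (r <= n)%N then p r else q (n.*2 - r)%N.

Definition walk_pair p q : Prop :=
  [/\ incidence_seq I n p, non_stammering n p, incidence_seq I n q
    , non_stammering n q & p 0%N = q 0%N /\ p n = q n].

Let n_ge2 : (2 <= n)%N := gp_ge2 ngon.

Section Cycle.

Variables (p q : nat -> P + B) (pq : walk_pair p q).

Let c := there_and_back p q.

Lemma cycle_periodic i : c (i + n.*2)%N = c i.
Proof. by rewrite /c /there_and_back modnDr. Qed.

Lemma cycle_there i : (i <= n)%N -> c i = p i.
Proof. by move=> lein; rewrite /c /there_and_back modn_small ?lein //; lia. Qed.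

Lemma cycle_back i : (i <= n)%N -> c (n.*2 - i)%N = q i.
Proof.
have [_ _ _ _ [pq0 pqn]] := pq; move=> lein; rewrite /c /there_and_back.
case: i lein => [_|i ltin]; first by rewrite subn0 modnn.
rewrite modn_small; last by lia.
case: leqP => lei; last by congr q; lia.
by rewrite (_ : n.*2 - i.+1 = n)%N ?pqn; [congr q|]; lia.
Qed.

Lemma cycle_walk i : incident I (c i) (c i.+1).
Proof.
have [pI _ qI _ _] := pq.
elim/periodic_ind: i => [i lti|i]; last by rewrite -addSn !cycle_periodic.
case: (ltnP i n) => leni; first by rewrite !cycle_there; [apply: pI|lia..].
rewrite -(subKn (ltnW lti)) -(_ : n.*2 - (n.*2 - i.+1) = (n.*2 - (n.*2 - i)).+1)%N;
  last by lia.
rewrite !cycle_back; [|by lia..].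
rewrite -(_ : (n.*2 - i.+1).+1 = n.*2 - i)%N; last by lia.
by apply/incident_sym/qI; lia.
Qed.

(** The closed walk does not turn back at its two ends either: at [p 0] this is
    [distinct_first_steps]. *)
Lemma cycle_nonstammering i : p n.-1 <> q n.-1 -> c i <> c i.+2.
Proof.
have [pI pN qI qN [pq0 pqn]] := pq => neq_pq.
have neq_pq1 := distinct_first_steps ngon pI pN qI qN pqn neq_pq.
elim/periodic_ind: i => [i lti|i]; last by rewrite -!addSn !cycle_periodic.
case: (ltngtP i.+1 n) => [ltin|ltni|in_].
- by rewrite !cycle_there; [apply: pN|lia..].
- have [i_lt|i_ge] := ltnP i.+1 n.*2.
    rewrite -(_ : n.*2 - (n.*2 - i.+2) = i.+2)%N; last by lia.
    rewrite -{1}(_ : n.*2 - (n.*2 - i.+2).+2 = i)%N; last by lia.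
    rewrite !cycle_back; [|by lia..].
    by apply/nesym/qN; lia.
  rewrite (_ : i.+2 = 1 + n.*2)%N; last by lia.
  rewrite (_ : i = n.*2 - 1)%N; last by lia.
  by rewrite cycle_periodic cycle_back ?cycle_there; [apply/nesym| lia..].
- rewrite -in_ /= in neq_pq; rewrite cycle_there; last by lia.
  rewrite (_ : i.+2 = n.*2 - i)%N; last by lia.
  by rewrite cycle_back //; lia.
Qed.

Lemma turn_there i : (0 < i < n)%N -> turn c i = turn p i.
Proof. by move=> lti; rewrite /turn !cycle_there //; lia. Qed.

Lemma turn_back i : (0 < i < n)%N -> turn c (n.*2 - i)%N = turn q i.
Proof.
have [_ _ qI _ _] := pq => /andP[i_gt0 ltin].
rewrite /turn -(_ : n.*2 - i.+1 = (n.*2 - i).-1)%N; last by lia.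
rewrite -(_ : n.*2 - i.-1 = (n.*2 - i).+1)%N; last by lia.
rewrite !cycle_back; [|by lia..].
have iI : incident I (q i.-1) (q i) by rewrite -{2}(prednK i_gt0); apply: qI; lia.
by rewrite (@val_sym _ _ (q i)) //; exact/incident_sym/qI.
Qed.

Lemma sum_turn_back (f : nat -> R) :
  \sum_(n.+1 <= i < n.*2) f i * turn c i
  = \sum_(1 <= i < n) f (n.*2 - i)%N * turn q i.
Proof.
rewrite -[n.+1]add1n big_addn (_ : n.*2 - n = n)%N; last by lia.
rewrite big_nat_rev; apply: eq_big_nat => i lti.
by rewrite (_ : 1 + n - i.+1 + n = n.*2 - i)%N ?turn_back //; lia.
Qed.

(** The case [p = q] is allowed: the turns back occur at the indices 0 and [n],
    which carry no weight. *)
Lemma walk_pair_sum :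
  \sum_(1 <= i < n) a i * turn p i
  = \sum_(1 <= i < n) a (n.*2 - i)%N * turn q i.
Proof.
have [pI pN qI qN [pq0 _]] := pq.
rewrite -sum_turn_back -(eq_big_nat _ _ (F1 := fun i => a i * turn c i)); last first.
  by move=> i lti; rewrite turn_there.
apply: u4_turn => [i _||i lti in_neq]; first exact: cycle_walk.
  by rewrite -[n.*2]add0n cycle_periodic.
have [ltin|ltni] : (i < n \/ n < i)%N by lia.
  rewrite !cycle_there; [|by lia..].
  by have := pN i.-1; rewrite prednK; [apply|]; lia.
rewrite -(_ : n.*2 - (n.*2 - i.-1) = i.-1)%N; last by lia.
rewrite -{1}(_ : n.*2 - (n.*2 - i.+1) = i.+1)%N; last by lia.
rewrite !cycle_back; [|by lia..].
rewrite -(_ : (n.*2 - i.+1).+2 = n.*2 - i.-1)%N; last by lia.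
by apply/nesym/qN; lia.
Qed.

(** The two end values have coefficients [c_(n-k)] and [- c_k] rather than [c_k]
    and [- c_k], since this equation is also used to prove that they agree. *)
Lemma walk_pair_moment : p n.-1 <> q n.-1 ->
    (forall j, (0 < j < n)%N -> a j = a (n.*2 - j)%N) ->
  forall k, (k <= n)%N ->
    path_moment n a k (turn p) + path_moment n a k (turn q)
    = 2 * (signed_weight n a (n - k) * fine (u (p n.-1) (q n.-1))
           - signed_weight n a k * fine (u (q 1%N) (p 1%N))).
Proof.
move=> neq_pq a_odd.
have n_gt0 : (0 < n)%N := ltnW n_ge2.
(* The predecessor is taken after adding a period, so that [v 0] is the value at
   [p 0]. *)
pose v i : R := fine (u (c (i + n.*2).-1%N) (c i.+1)).
have v_turn i : (0 < i)%N -> v i = turn c i.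
  by case: i => // i _; rewrite /v addSn /= cycle_periodic.
apply: (@moment_pair _ _ _ v) => //.
- apply: cyclic_correlation => // [i|k].
    rewrite /v -addSn cycle_periodic; congr fine; congr u.
    by rewrite -(prednK (_ : 0 < i + n.*2)%N) ?addSn /= ?cycle_periodic //; lia.
  have xE i : (0 < i)%N -> v (i + k)%N = turn (fun j => c (j + k)%N) i.
    by case: i => // i _; rewrite v_turn ?addSn // /turn /= addSn.
  rewrite (eq_big_nat _ _ (F2 := fun i => a i * turn (fun j => c (j + k)%N) i)); last first.
    by move=> i /andP[i_gt0 _]; rewrite xE.
  rewrite [RHS](eq_big_nat _ _ (F2 := fun i => a i * turn (fun j => c (j + k)%N) i)); last first.
    by move=> i /andP[/ltnW i_gt0 _]; rewrite xE //; lia.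
  apply: u4_turn => [i _||i /andP[i_gt0 _] _]; first exact: cycle_walk.
    by rewrite add0n addnC cycle_periodic.
  by rewrite -{2}(prednK i_gt0); exact: cycle_nonstammering.
- rewrite /v add0n; congr fine; congr u; last by rewrite cycle_there //.
  by rewrite -subn1 cycle_back.
- rewrite v_turn // /turn cycle_there; last by lia.
  by rewrite (_ : n.+1 = n.*2 - n.-1)%N ?cycle_back //; lia.
- by move=> i lti; rewrite v_turn ?turn_there //; case/andP: lti.
- by move=> i lti; rewrite v_turn ?turn_back //; lia.
Qed.

End Cycle.

(** * Relations between the weights *)

Section Weights.

Variables (x0 w0 y0 : P + B).
Hypothesis (xw0 : incident I x0 w0) (wy0 : incident I w0 y0).
Hypothesis (xy0 : x0 <> y0) (u0_neq0 : u x0 y0 <> 0%E).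

Let d : R := fine (u x0 y0).
Local Notation c := (signed_weight n a).

Let n_gt0 : (0 < n)%N := ltnW n_ge2.

Lemma base_value_gt0 : 0 < d.
Proof.
have yw0 := incident_sym wy0.
rewrite fine_gt0 // lt0e (val_ge0 uval) ?andbT; last by exists w0.
by rewrite (introN eqP u0_neq0) -ge0_fin_numE ?(val_fin xw0) // (val_ge0 uval) //; exists w0.
Qed.

Lemma single_turn_walk j : (0 < j)%N -> exists s,
  [/\ forall i, incident I (s i) (s i.+1), forall i, s i <> s i.+2
    & forall i, (0 < i)%N -> turn s i = if i == j then d else 0].
Proof.
move=> j_gt0; have [s [sI sN su]] := one_turn_walk xw0 wy0 xy0 j_gt0.
by exists s; split=> // i i_gt0; rewrite /turn su //; case: ifP.
Qed.

Lemma sum_single_turn (f : nat -> R) s j :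
    (forall i, (0 < i)%N -> turn s i = if i == j then d else 0) ->
  \sum_(1 <= i < n) f i * turn s i = if (0 < j < n)%N then f j * d else 0.
Proof.
move=> sE; rewrite (eq_big_nat _ _ (F2 := fun i => if i == j then f i * d else 0)).
  by rewrite -big_mkcond big_nat1_eq.
by move=> i /andP[i_gt0 _]; rewrite sE //; case: ifP; rewrite ?mulr0.
Qed.

(** Go along a walk with the single nonzero value [d] at [j] and return: [d]
    occurs at [j] and at [2n - j]. *)
Lemma weight_opp j : (0 < j < n)%N -> a j = a (n.*2 - j)%N.
Proof.
move=> ltj; have /andP[j_gt0 _] := ltj.
have [s [sI sN sE]] := single_turn_walk j_gt0.
have ss : walk_pair s s by split.
have := walk_pair_sum ss.
rewrite (sum_single_turn a sE) (sum_single_turn (fun i => a (n.*2 - i)%N) sE) ltj.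
by apply: mulIf; rewrite gt_eqF ?base_value_gt0.
Qed.

Lemma weight_gt0 j : (0 < j < n)%N -> 0 < c j.
Proof.
move=> ltj; rewrite signed_weight_pos //; apply: (val_weight_gt0 uval).
by rewrite /weight_index; lia.
Qed.

(** In an n-gon with values 0 along [p] and [d] at [p n], all values vanish by
    positivity except at [p 0], where the value is some [e].  The equations
    [c_(n-k) d = c_k e] for [k] and for [n - k] force [e = d]. *)
Lemma weight_rev k : (0 < k < n)%N -> c (n - k)%N = c k.
Proof.
move=> ltk; have [p [pI pN pE]] := single_turn_walk n_gt0.
have [q [qI qN q0 qn qy]] := opposite_walk ngon (fun i _ => pI i) (fun i _ => pN i) (pI n).
have pq : walk_pair p q by split.
have neq_pq : p n.-1 <> q n.-1.
  by rewrite qy -{2}(prednK n_gt0); exact: pN.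
have p_sum f : \sum_(1 <= i < n) f i * turn p i = 0.
  by rewrite (sum_single_turn f pE) ltnn andbF.
have q_ge0 i : (0 < i < n)%N -> 0 <= turn q i.
  move=> lti; rewrite -(turn_back pq) //; apply: turn_ge0; last by lia.
  exact: cycle_walk.
have qE i : (0 < i < n)%N -> turn q i = 0.
  have := walk_pair_sum pq; rewrite p_sum => /esym/eqP.
  rewrite big_nat_cond psumr_eq0 => [/allP q0E lti|j]; last first.
    rewrite andbT => ltj; apply: mulr_ge0; last exact: q_ge0.
    apply/ltW/(val_weight_gt0 uval); rewrite /weight_index; lia.
  have := q0E i; rewrite mem_index_iota => /(_ lti); rewrite lti /= mulf_eq0.
  case/orP=> /eqP // ai0; have: 0 < a (n.*2 - i)%N.
    by apply: (val_weight_gt0 uval); rewrite /weight_index; lia.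
  by rewrite ai0 ltxx.
set e := fine (u (q 1%N) (p 1%N)).
have cE j : (0 < j < n)%N -> c (n - j)%N * d = c j * e.
  move=> ltj; have := walk_pair_moment pq neq_pq weight_opp (k := j) ltac:(lia).
  rewrite {1}/path_moment p_sum.
  rewrite {1}/path_moment (eq_big_nat _ _ (F2 := fun=> 0)) ?big1_eq; last first.
    by move=> i lti; rewrite qE ?mulr0.
  have -> : fine (u (p n.-1) (q n.-1)) = d.
    by have := pE n n_gt0; rewrite eqxx qy.
  rewrite addr0 => /esym/eqP; rewrite mulf_eq0 pnatr_eq0 /= subr_eq0.
  by move/eqP.
have ck := cE k ltk; have cnk := cE (n - k)%N ltac:(lia).
rewrite subKn in cnk; last by lia.
have c_gt0 := weight_gt0 ltk; have cn_gt0 : 0 < c (n - k)%N by apply: weight_gt0; lia.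
have d_gt0 := base_value_gt0.
have ed : e = d.
  have : (c k + c (n - k)%N) * (e - d) = 0 by rewrite mulrDl !mulrBr -ck -cnk; ring.
  by move/eqP; rewrite mulf_eq0 gt_eqF ?addr_gt0 //= subr_eq0 => /eqP.
by move: ck; rewrite ed; apply: mulIf; rewrite gt_eqF.
Qed.

Lemma two_more_neighbours x z : exists y1 y2,
  [/\ incident I z y1, incident I z y2, y1 <> x, y2 <> x & y1 <> y2].
Proof.
have [y1 [y2 [y3 [[zy1 zy2 zy3] [y12 y13 y23]]]]] := gp1 ngon z.
have [y1x|y1x] := pselect (y1 = x).
  by exists y2, y3; split=> //; rewrite -y1x; exact: nesym.
have [y2x|y2x] := pselect (y2 = x).
  by exists y1, y3; split=> //; rewrite -y2x; exact: nesym.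
by exists y1, y2.
Qed.

(** Thickness gives walks [q] and [r] forming an n-gon with [p] and with each
    other; the sum of the equations for [p, q] and [p, r] minus the one for
    [q, r] leaves only the moment of [p]. *)
Lemma moment_proportional p : incidence_seq I n p -> non_stammering n p ->
  exists m, forall k, (0 < k < n)%N -> path_moment n a k (turn p) = c k * m.
Proof.
move=> pI pN; have [y [z [py pz yp zp yz]]] := two_more_neighbours (p n.-1) (p n).
have [q [qI qN q0 qn qy]] := opposite_walk ngon pI pN py.
have [r [rI rN r0 rn rz]] := opposite_walk ngon pI pN pz.
have pq : walk_pair p q by split.
have pr : walk_pair p r by split.
have qr : walk_pair q r by split; rewrite ?q0 ?qn.
have npq : p n.-1 <> q n.-1 by rewrite qy; exact: nesym.
have npr : p n.-1 <> r n.-1 by rewrite rz; exact: nesym.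
have nqr : q n.-1 <> r n.-1 by rewrite qy rz.
pose dl s t := fine (u (s n.-1) (t n.-1)) - fine (u (t 1%N) (s 1%N)).
exists (dl p q + dl p r - dl q r) => k ltk.
have lek : (k <= n)%N by lia.
have := walk_pair_moment pq npq weight_opp lek.
have := walk_pair_moment pr npr weight_opp lek.
have := walk_pair_moment qr nqr weight_opp lek.
rewrite weight_rev // /dl; lra.
Qed.

(** The moments of a walk whose only nonzero value is at index 1. *)
Lemma weight_recurrence : exists l : R, forall k, (0 < k < n)%N ->
  c k.+1 + c k.-1 = l * c k.
Proof.
have [p [pI pN pE]] := single_turn_walk (isT : (0 < 1)%N).
have [m mE] := moment_proportional (fun i _ => pI i) (fun i _ => pN i).
have d_neq0 : d != 0 by rewrite gt_eqF ?base_value_gt0.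
exists (m / d) => k ltk; have := mE k ltk.
rewrite /path_moment (sum_single_turn _ pE) n_ge2 /= /reflected_weight.
rewrite (signed_weight_odd n_gt0 weight_opp (i := (1 + (n.*2 - k))%N) (j := k.-1)); last first.
  by apply/dvdnP; exists 1%N; lia.
rewrite opprK add1n mulrAC [m * _]mulrC => <-.
by rewrite mulfK.
Qed.

Lemma weights_sine : exists C : R, forall i, weight_index n i ->
  a i = C * `|sin (i%:R * pi / n%:R)|.
Proof.
have [l crec] := weight_recurrence.
have [C CE] := sine_unique n_ge2 (signed_weight0 n a) (signed_weight_half a n_gt0)
  weight_gt0 crec.
have small i : (0 < i < n)%N -> a i = C * `|sin (i%:R * pi / n%:R)|.
  move=> lti; rewrite -(signed_weight_pos a lti) CE; last by lia.
  by rewrite gtr0_norm ?sine_gt0.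
exists C => i /and3P[i_gt0 lei in_neq].
have [ltin|ltni] : (i < n \/ n < i)%N by lia.
  by rewrite small ?i_gt0.
rewrite -(_ : n.*2 - (n.*2 - i) = i)%N; last by lia.
rewrite -weight_opp ?small; [|by lia..].
congr (_ * _).
have n_neq0 : n%:R != 0 :> R by rewrite pnatr_eq0 -lt0n.
rewrite [in RHS]natrB; last by lia.
rewrite -addnn natrD !mulrBl !mulrDl [n%:R * pi / _]mulrAC divff // mul1r.
rewrite addrC addrA !sinDpi opprK sinN normrN //.
Qed.

End Weights.
End Values.

Theorem mainTheorem1 (R : realType) (n : nat) (P B : Type) (I : P -> B -> Prop)
    (a : nat -> R) (u : P + B -> P + B -> \bar R)
    (Gamma_ngon : generalized_polygon n I)
    (u_val : valuation n I a u)
    (u_nonzero : exists x y : P + B,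
       [/\ adjacent_elts I x y, x <> y & u x y <> 0%E]) :
  exists c : R, forall i : nat, weight_index n i ->
    a i = c * `|sin (i%:R * pi / n%:R)|.
Proof.
have [x [y [[z [xz yz]] xy uxy]]] := u_nonzero.
exact: (weights_sine Gamma_ngon u_val xz (incident_sym yz) xy uxy).
Qed.
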